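(* Suppose Algorithm 1 (defined in the context) is run with parameters $V=\sqrt{T}$ and $\alpha=T$. Then for all $T\ge 1$, $$\mathbb{E}\Big[\sum_{t=1}^{T} g_k^t(\mathbf{x}(t))\Big]\le O(\sqrt{T}),\qquad \forall k\in\{1,2,\ldots,m\},$$ where the expectation is with respect to all $\omega(t)$. That is, there is a constant $C$ depending only on $m,D_1,D_2,G,R,\epsilon$ such that for every integer $T\ge1$ and every $k\in\{1,\ldots,m\}$, the left-hand side (for Algorithm 1 run with $V=\sqrt T$, $\alpha=T$) is at most $C\sqrt{T}$.
   Context: Setting. $\mathcal{X}_0\subset\mathbb{R}^n$ is a nonempty compact convex set. $\omega$ is a random variable with values in $\Omega$, and $\omega(1),\omega(2),\ldots$ are i.i.d. samples of $\omega$. For $k\in\{1,\ldots,m\}$, $g_k(\mathbf{x};\omega)$ is convex in $\mathbf{x}\in\mathcal{X}_0$ for each $\omega\in\Omega$. Write $g_k^t(\mathbf{x})=g_k(\mathbf{x};\omega(t))$, $\mathbf{g}(\mathbf{x};\omega)=[g_1(\mathbf{x};\omega),\ldots,g_m(\mathbf{x};\omega)]^{\mathsf T}$, $\mathbf{g}^t(\mathbf{x})=\mathbf{g}(\mathbf{x};\omega(t))$, $\tilde g_k(\mathbf{x})=\mathbb{E}_\omega[g_k(\mathbf{x};\omega)]$, $\tilde{\mathbf g}=[\tilde g_1,\ldots,\tilde g_m]^{\mathsf T}$. The loss functions $f^t$, $t=1,2,\ldots$, are convex on $\mathcal{X}_0$ and may vary arbitrarily, as long as each $f^t$ is independent of all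 $\omega(\tau)$ with $\tau\ge t+1$ (for example $f^t$ may be chosen adversarially based on $\omega(1),\ldots,\omega(t)$ and $\mathbf{x}(1),\ldots,\mathbf{x}(t)$). The samples $\omega(\cdot)$ are the only source of randomness: with $\mathcal{W}(0)=\{\emptyset,\Omega\}$ the trivial $\sigma$-algebra and $\mathcal{W}(t)=\sigma(\omega(1),\ldots,\omega(t))$, $f^t$ is determined by $\omega(1),\ldots,\omega(t)$, and $\mathbf{x}(t)$ and $\mathbf{Q}(t)$ below are $\mathcal{W}(t-1)$-measurable for all $t\ge1$. $\|\cdot\|$ is the Euclidean norm. $\nabla h(\mathbf{x})$ denotes a subgradient of the convex function $h$ at $\mathbf{x}$, i.e. $h(\mathbf{y})\ge h(\mathbf{x})+[\nabla h(\mathbf{x})]^{\mathsf T}[\mathbf{y}-\mathbf{x}]$ for all $\mathbf{y}\in\mathcal{X}_0$. Assumption (basic). There are constants $D_1,D_2,G,R>0$ such that $\|\nabla f^t(\mathbf{x})\|\le D_1$, $\|\nabla g_k(\mathbf{x};\omega)\|\le D_2$, $\|\mathbf{g}(\mathbf{x};\omega)\|\le G$ and $\|\mathbf{x}-\mathbf{y}\|\le R$ for all $\mathbf{x},\mathbf{y}\in\mathcal{X}_0$, all $t$, all $\omega\in\Omega$ and all $k$. Assumption (Slater). There are $\epsilon>0$ and $\hat{\mathbf{x}}\in\mathcal{X}_0$ with $\tilde g_k(\hat{\mathbf{x}})\le-\epsilon$ for all $k\in\{1,\ldots,m\}$. Algorithm 1. Parameters $V>0$, $\alpha>0$. Choose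 $\mathbf{x}(1)\in\mathcal{X}_0$ arbitrarily and set $Q_k(1)=0$ for all $k$. At the end of each round $t\in\{1,2,\ldots\}$, observe $f^t,\mathbf{g}^t$ and: (i) let $\mathbf{x}(t+1)$ be the minimizer over $\mathbf{x}\in\mathcal{X}_0$ of $V[\nabla f^t(\mathbf{x}(t))]^{\mathsf T}[\mathbf{x}-\mathbf{x}(t)]+\sum_{k=1}^m Q_k(t)[\nabla g_k^t(\mathbf{x}(t))]^{\mathsf T}[\mathbf{x}-\mathbf{x}(t)]+\alpha\|\mathbf{x}-\mathbf{x}(t)\|^2$; (ii) set $Q_k(t+1)=\max\{Q_k(t)+g_k^t(\mathbf{x}(t))+[\nabla g_k^t(\mathbf{x}(t))]^{\mathsf T}[\mathbf{x}(t+1)-\mathbf{x}(t)],0\}$ for each $k$. The same subgradients are used in (i) and (ii). Write $\mathbf{Q}(t)=[Q_1(t),\ldots,Q_m(t)]^{\mathsf T}$. *)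

(* Defs.v *)
From HB Require Import structures.
From mathcomp Require Import all_boot all_order all_algebra.
From mathcomp Require Import all_classical all_reals all_analysis.

Set Implicit Arguments.
Unset Strict Implicit.
Unset Printing Implicit Defensive.

Import Order.TTheory GRing.Theory Num.Theory.
Import numFieldNormedType.Exports.

Local Open Scope classical_set_scope.
Local Open Scope ring_scope.

Definition dotp (R : realType) (n : nat) (u v : 'rV[R]_n) : R :=
  \sum_(i < n) u 0 i * v 0 i.

(* The library's norm `|v| on matrices is the sup norm. *)
Definition enorm (R : realType) (n : nat) (v : 'rV[R]_n) : R :=
  Num.sqrt (dotp v v).

(* Subgradients are relative to X0: the inequality is required only at the
   points of X0. *)
Definition is_subgradient (R : realType) (n : nat) (X0 : set 'rV[R]_n)
    (h : 'rV[R]_n -> R) (x v : 'rV[R]_n) : Prop :=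
  forall y, X0 y -> h x + dotp v (y - x) <= h y.

Definition is_minimizer (R : realType) (n : nat) (X0 : set 'rV[R]_n)
    (h : 'rV[R]_n -> R) (x : 'rV[R]_n) : Prop :=
  X0 x /\ forall y, X0 y -> h x <= h y.

(* Rounds and samples are numbered from 1; the values at index 0 of all
   sequences are irrelevant. *)

Definition mutually_independent (R : realType) (d d' : measure_display)
    (S : measurableType d) (Om : measurableType d') (P : probability S R)
    (omega : nat -> {RV P >-> Om}) : Prop :=
  forall (I : seq nat) (B : nat -> set Om),
    uniq I -> (forall t, t \in I -> (1 <= t)%N) ->
    (forall t, measurable (B t)) ->
    P (\bigcap_(t in [set` I]) (omega t @^-1` B t)) =
    (\prod_(t <- I) P (omega t @^-1` B t))%E.

(* mu is the law of the random variable of which the omega t are samples. *)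
Definition iid_samples (R : realType) (d d' : measure_display)
    (S : measurableType d) (Om : measurableType d') (P : probability S R)
    (mu : probability Om R) (omega : nat -> {RV P >-> Om}) : Prop :=
  mutually_independent omega /\
  forall t (B : set Om), (1 <= t)%N -> measurable B ->
    distribution P (omega t) B = mu B.

(* The sigma-algebra generated by omega 1, ..., omega t; it is trivial for
   t = 0. *)
Definition samples_sigma (R : realType) (d d' : measure_display)
    (S : measurableType d) (Om : measurableType d') (P : probability S R)
    (omega : nat -> {RV P >-> Om}) (t : nat) : set (set S) :=
  g_sigma_preimage (fun i : 'I_t => (omega i.+1 : S -> Om)).

Definition samples_measurable (R : realType) (d d' : measure_display)
    (S : measurableType d) (Om : measurableType d') (P : probability S R)
    (omega : nat -> {RV P >-> Om}) (t n : nat) (X : S -> 'rV[R]_n) : Prop :=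
  forall (i : 'I_n) (B : set R), measurable B ->
    samples_sigma omega t ((fun s => X s 0 i) @^-1` B).

(* The random function h on X0 depends on the outcome only through
   omega 1, ..., omega t. *)
Definition determined_by_samples (R : realType) (d d' : measure_display)
    (S : measurableType d) (Om : measurableType d') (P : probability S R)
    (omega : nat -> {RV P >-> Om}) (t n : nat) (X0 : set 'rV[R]_n)
    (h : S -> 'rV[R]_n -> R) : Prop :=
  forall s s' : S,
    (forall i, (1 <= i <= t)%N -> omega i s = omega i s') ->
    forall x, X0 x -> h s x = h s' x.

(* The maps gradf and gradg fix the subgradients used by the algorithm. Only
   these are bounded: at a boundary point of X0 the set of all subgradients
   relative to X0 is unbounded. *)
Record basic_assumption (R : realType) (S Om : Type) (n m : nat)
    (X0 : set 'rV[R]_n)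
    (f : nat -> S -> 'rV[R]_n -> R) (gradf : nat -> S -> 'rV[R]_n -> 'rV[R]_n)
    (g : 'I_m -> 'rV[R]_n -> Om -> R)
    (gradg : 'I_m -> 'rV[R]_n -> Om -> 'rV[R]_n)
    (D1 D2 G Rad : R) : Prop := BasicAssumption {
  gradf_subgradient : forall t s x, (1 <= t)%N -> X0 x ->
    is_subgradient X0 (f t s) x (gradf t s x);
  gradf_bound : forall t s x, (1 <= t)%N -> X0 x -> enorm (gradf t s x) <= D1;
  gradg_subgradient : forall k w x, X0 x ->
    is_subgradient X0 (fun y => g k y w) x (gradg k x w);
  gradg_bound : forall k w x, X0 x -> enorm (gradg k x w) <= D2;
  g_bound : forall w x, X0 x -> enorm (\row_(k < m) g k x w) <= G;
  diameter_bound : forall x y, X0 x -> X0 y -> enorm (x - y) <= Rad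
}.

Definition slater (R : realType) (d' : measure_display)
    (Om : measurableType d') (mu : probability Om R) (n m : nat)
    (X0 : set 'rV[R]_n) (g : 'I_m -> 'rV[R]_n -> Om -> R) (eps : R) : Prop :=
  exists2 xhat, X0 xhat & forall k, ('E_mu[g k xhat] <= (- eps)%:E)%E.

(* A single realization of the algorithm: gradf t, gt t k and gradg t k are the
   subgradient of the loss, the k-th constraint function and its subgradient
   revealed in round t. *)
Record algorithm1_run (R : realType) (n m : nat) (V alpha : R)
    (X0 : set 'rV[R]_n) (gradf : nat -> 'rV[R]_n -> 'rV[R]_n)
    (gt : nat -> 'I_m -> 'rV[R]_n -> R)
    (gradg : nat -> 'I_m -> 'rV[R]_n -> 'rV[R]_n)
    (x : nat -> 'rV[R]_n) (Q : nat -> 'rV[R]_m) : Prop := Algorithm1Run {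
  run_x1 : X0 (x 1%N);
  run_Q1 : Q 1%N = 0;
  run_x : forall t, (1 <= t)%N ->
    is_minimizer X0
      (fun y => V * dotp (gradf t (x t)) (y - x t)
        + \sum_(k < m) Q t 0 k * dotp (gradg t k (x t)) (y - x t)
        + alpha * enorm (y - x t) ^+ 2)
      (x t.+1);
  run_Q : forall t (k : 'I_m), (1 <= t)%N ->
    Q t.+1 0 k =
      Num.max (Q t 0 k + gt t k (x t)
               + dotp (gradg t k (x t)) (x t.+1 - x t)) 0
}.

(* Main.v *)
Require Import Defs.
From mathcomp Require Import all_boot all_order all_algebra.
From mathcomp Require Import all_classical all_reals all_analysis.
From mathcomp Require Import measurable_realfun.
From mathcomp Require Import ring lra.

(** Unfolding the queue recursion [Q_k(t+1) >= Q_k(t) + g_k + <grad, step>]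
    bounds the cumulative constraint value by [Q_k(T+1)] plus [D2] times the
    total length of the steps ([constraint_sum_le]), and the minimization
    defining [x(t+1)] bounds each step by [(V D1 + D2 * sum_k Q_k(t)) / alpha]
    ([step_length]).  With [V = sqrt T] and [alpha = T], everything therefore
    reduces to a bound [E Q_k(t) = O(sqrt T)] that is uniform in [t].

    Let [z] be the Slater point.  The quantity to follow is
    [Y(t) = sqrt (|Q(t)|^2 + 2 alpha |x(t) - z|^2)] ([lyapunov]).  Comparing the
    proximal step with [z] costs the change of [alpha |x - z|^2]; once this term
    is part of the potential, a single round satisfies
      [Y(t+1)^2 <= Y(t)^2 + 2 sum_k Q_k(t) g_k(z; omega(t)) + 2 c sqrt T]
    for a constant [c] ([lyapunov_step]).  As [Q(t)] is a function of the
    samples before round [t], independence ([samples_mean_le]) and the Slater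
    condition make the conditional mean of the middle term at most
    [- 2 eps sum_k Q_k(t)].  Moreover [|x(t) - z| <= Rad], so [|Q(t)|] is
    comparable to [Y(t)] as soon as [Y(t) >= K sqrt T] ([lyapunov_le_sum]).
    Above that level [Y] thus has increments bounded from above and a drift
    bounded away from [0], downwards.

    Such a drift controls every [E Y(t)], and not only their average over time,
    once it is exponentiated: [E exp (r (Y(t) - L sqrt T))] satisfies an affine
    recursion of ratio [1 - r eps / 4] ([exp_drift], [exp_moment_step]), hence
    stays below [4 / (r eps)], and [y <= exp y] gives
    [E Y(t) <= L sqrt T + 4 / (r^2 eps)] ([drift_mean_bound]). *)

Set Implicit Arguments.
Unset Strict Implicit.
Unset Printing Implicit Defensive.

Import Order.TTheory GRing.Theory Num.Theory.
Import numFieldNormedType.Exports.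

Local Open Scope classical_set_scope.
Local Open Scope ring_scope.

(** * Euclidean geometry and proximal steps *)

Section euclidean.
Context {R : realType} {n : nat}.
Implicit Types (u v w : 'rV[R]_n) (a : R).

Lemma dotpC u v : dotp u v = dotp v u.
Proof. by apply: eq_bigr => i _; rewrite mulrC. Qed.

Lemma dotpDr u v w : dotp u (v + w) = dotp u v + dotp u w.
Proof. by rewrite -big_split; apply: eq_bigr => i _; rewrite !mxE mulrDr. Qed.

Lemma dotpZr a u v : dotp u (a *: v) = a * dotp u v.
Proof. by rewrite mulr_sumr; apply: eq_bigr => i _; rewrite !mxE; ring. Qed.

Lemma dotpNr u v : dotp u (- v) = - dotp u v.
Proof. by rewrite -scaleN1r dotpZr mulN1r. Qed.

Lemma dotpDl u v w : dotp (u + v) w = dotp u w + dotp v w.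
Proof. by rewrite dotpC dotpDr !(dotpC w). Qed.

Lemma dotpZl a u v : dotp (a *: u) v = a * dotp u v.
Proof. by rewrite dotpC dotpZr dotpC. Qed.

Lemma dotpNl u v : dotp (- u) v = - dotp u v.
Proof. by rewrite dotpC dotpNr dotpC. Qed.

Lemma dotp_suml (I : finType) (F : I -> 'rV[R]_n) v :
  dotp (\sum_i F i) v = \sum_i dotp (F i) v.
Proof.
rewrite exchange_big; apply: eq_bigr => j _.
by rewrite summxE mulr_suml.
Qed.

Lemma dotp_ge0 u : 0 <= dotp u u.
Proof. by apply: sumr_ge0 => i _; rewrite -expr2 sqr_ge0. Qed.

Lemma enorm_ge0 u : 0 <= enorm u.
Proof. exact: sqrtr_ge0. Qed.

Lemma enorm_sqr u : enorm u ^+ 2 = dotp u u.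
Proof. by rewrite sqr_sqrtr// dotp_ge0. Qed.

Lemma dotp_enorm0 u v : enorm u = 0 -> dotp u v = 0.
Proof.
move=> u0; have /eqP := enorm_sqr u.
rewrite u0 expr0n /= eq_sym psumr_eq0 => [/allP ui0|i _]; last first.
  by rewrite -expr2 sqr_ge0.
apply: big1 => i _; have /eqP := eqP (ui0 i (mem_index_enum i)).
by rewrite mulf_eq0 orbb => /eqP ->; rewrite mul0r.
Qed.

(** Cauchy-Schwarz, from the nonnegativity of the square of
    [|v| u - |u| v]. *)
Lemma dotp_le u v : dotp u v <= enorm u * enorm v.
Proof.
have := enorm_ge0 u; rewrite le_eqVlt => /predU1P[u0|u_gt0].
  by rewrite dotp_enorm0// -u0 mul0r.
have := enorm_ge0 v; rewrite le_eqVlt => /predU1P[v0|v_gt0].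
  by rewrite dotpC dotp_enorm0// -v0 mulr0.
have := dotp_ge0 (enorm v *: u - enorm u *: v).
rewrite !(dotpDl, dotpDr, dotpNl, dotpNr, dotpZl, dotpZr) -!enorm_sqr.
rewrite (dotpC v u) => h; rewrite -subr_ge0.
by rewrite -(pmulr_rge0 _ (mulr_gt0 u_gt0 v_gt0)); lra.
Qed.

Lemma enormN u : enorm (- u) = enorm u.
Proof. by rewrite /enorm dotpNl dotpNr opprK. Qed.

Lemma dotp_norm_le u v : `|dotp u v| <= enorm u * enorm v.
Proof.
by rewrite ler_norml dotp_le andbT lerNl -dotpNl -(enormN u) dotp_le.
Qed.

Lemma enorm0 : enorm (0 : 'rV[R]_n) = 0.
Proof. by rewrite /enorm -(scale0r 0) dotpZl mul0r sqrtr0. Qed.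

Lemma dotp0r u : dotp u 0 = 0.
Proof. by rewrite -(scale0r 0) dotpZr mul0r. Qed.

Lemma enormZ a u : 0 <= a -> enorm (a *: u) = a * enorm u.
Proof.
move=> a0; rewrite /enorm dotpZl dotpZr mulrA -expr2 sqrtrM ?sqr_ge0//.
by rewrite sqrtr_sqr ger0_norm.
Qed.

Lemma enormD u v : enorm (u + v) <= enorm u + enorm v.
Proof.
rewrite -(@ler_pXn2r _ 2) ?nnegrE ?addr_ge0 ?enorm_ge0// sqrrD !enorm_sqr.
by rewrite !(dotpDl, dotpDr) (dotpC v); have := dotp_le u v; lra.
Qed.

Lemma enorm_sum (I : finType) (F : I -> 'rV[R]_n) :
  enorm (\sum_i F i) <= \sum_i enorm (F i).
Proof.
elim/big_ind2 : _ => [|u a v b ua vb|//]; first by rewrite enorm0.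
by rewrite (le_trans (enormD _ _))// lerD.
Qed.

Lemma coord_enorm_le u i : `|u 0 i| <= enorm u.
Proof.
rewrite -(@ler_pXn2r _ 2) ?nnegrE ?enorm_ge0// real_normK ?num_real//.
rewrite enorm_sqr /dotp (bigD1 i)//= -expr2 lerDl sumr_ge0// => j _.
by rewrite -expr2 sqr_ge0.
Qed.

Lemma enorm_le_sum u : (forall i, 0 <= u 0 i) -> enorm u <= \sum_i u 0 i.
Proof.
move=> u0; rewrite -(@ler_pXn2r _ 2) ?nnegrE ?enorm_ge0 ?sumr_ge0//.
rewrite enorm_sqr expr2 mulr_suml; apply: ler_sum => i _.
by rewrite ler_wpM2l// (bigD1 i)//= lerDl sumr_ge0.
Qed.

End euclidean.

(** The first-order optimality condition at the end point of a segment: for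
    small [l] the linear term dominates. *)
Lemma linear_coef_ge0 (R : realFieldType) (a b : R) : 0 <= b ->
  (forall l, 0 < l <= 1 -> 0 <= l * a + l ^+ 2 * b) -> 0 <= a.
Proof.
move=> b0 h; rewrite leNgt; apply/negP => a0.
have ba : 0 < b - a by lra.
(* At this [l] the quadratic equals [- l * a^2 / (b - a)]. *)
have l0 : 0 < - a / (b - a) by rewrite divr_gt0// oppr_gt0.
have := h (- a / (b - a)); rewrite l0 /= ler_pdivrMr// mul1r lerBrDr.
rewrite addNr => /(_ b0).
rewrite (_ : _ + _ = - a / (b - a) * - (a ^+ 2 / (b - a))).
  by rewrite pmulr_rge0// oppr_ge0 leNgt divr_gt0// exprn_even_gt0//= lt_eqF.
by field; rewrite lt0r_neq0.
Qed.

(** A minimizer [x'] of a strongly convex function beats any other point [z] by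
    a quadratic margin [alpha |x' - z|^2].  When the [x'] are successive
    iterates, the terms [alpha |x - z|^2] and [alpha |x' - z|^2] telescope. *)
Lemma minimizer_three_points (R : realType) (n : nat) (X0 : set 'rV[R]_n)
    (c x x' z : 'rV[R]_n) (alpha : R) :
  convex_set X0 -> 0 <= alpha ->
  is_minimizer X0 (fun y => dotp c (y - x) + alpha * enorm (y - x) ^+ 2) x' ->
  X0 z ->
  dotp c (x' - x) + alpha * enorm (x' - x) ^+ 2 + alpha * enorm (x' - z) ^+ 2
  <= dotp c (z - x) + alpha * enorm (x - z) ^+ 2.
Proof.
move=> cX0 alpha0 [X0x' minx'] X0z.
suff : 0 <= dotp c (z - x') + 2 * alpha * dotp (x' - x) (z - x').
  rewrite !enorm_sqr !(dotpDl, dotpDr, dotpNl, dotpNr).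
  by rewrite !(dotpC z) !(dotpC x'); lra.
apply: (@linear_coef_ge0 _ _ (alpha * enorm (z - x') ^+ 2)).
  by rewrite mulr_ge0// sqr_ge0.
move=> l /andP[l0 l1].
have l01 : Itv.spec (@Itv.num_sem R) (Itv.Real `[0%Z, 1%Z]) l.
  by apply/and3P; split; rewrite ?num_real//= bnd_simp// ltW.
have X0y : X0 (l *: z + (1 - l) *: x').
  by have := cX0 z x' (Itv.mk l01); rewrite !inE; apply.
have {X0y} := minx' _ X0y.
rewrite scalerBl scale1r !enorm_sqr.
rewrite !(dotpDl, dotpDr, dotpNl, dotpNr, dotpZl, dotpZr).
by rewrite !(dotpC z) !(dotpC x'); lra.
Qed.

(** Staying at [x] costs [0], so the linear gain [- dotp c (x' - x)] must pay
    for the quadratic penalty. *)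
Lemma minimizer_step_length (R : realType) (n : nat) (X0 : set 'rV[R]_n)
    (c x x' : 'rV[R]_n) (alpha : R) : X0 x ->
  is_minimizer X0 (fun y => dotp c (y - x) + alpha * enorm (y - x) ^+ 2) x' ->
  alpha * enorm (x' - x) <= enorm c.
Proof.
move=> X0x [_ /(_ _ X0x)]; rewrite subrr dotp0r enorm0 expr0n /= mulr0 addr0.
have := enorm_ge0 (x' - x); rewrite le_eqVlt => /predU1P[<- _|e_gt0 h].
  by rewrite mulr0 enorm_ge0.
rewrite -(ler_pM2r e_gt0); have := dotp_le (- c) (x' - x).
by rewrite dotpNl enormN; lra.
Qed.

(** * Realizations of the algorithm *)

Section algorithm_run.
Context {R : realType} {n m : nat} {V alpha : R} {X0 : set 'rV[R]_n}.
Context {gradf : nat -> 'rV[R]_n -> 'rV[R]_n}.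
Context {gt : nat -> 'I_m -> 'rV[R]_n -> R}.
Context {gradg : nat -> 'I_m -> 'rV[R]_n -> 'rV[R]_n}.
Context {x : nat -> 'rV[R]_n} {Q : nat -> 'rV[R]_m}.
Context {D1 D2 G Rad : R}.
Context (convX0 : convex_set X0).
Context (V_ge0 : 0 <= V) (alpha_ge0 : 0 <= alpha).
Context (gradf_le : forall t y, (1 <= t)%N -> X0 y -> enorm (gradf t y) <= D1).
Context (gradg_sub : forall t k y, (1 <= t)%N -> X0 y ->
  is_subgradient X0 (gt t k) y (gradg t k y)).
Context (gradg_le : forall t k y, (1 <= t)%N -> X0 y ->
  enorm (gradg t k y) <= D2).
Context (gt_le : forall t k y, (1 <= t)%N -> X0 y -> `|gt t k y| <= G).
Context (diam_le : forall y z, X0 y -> X0 z -> enorm (y - z) <= Rad).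
Context (run : algorithm1_run V alpha X0 gradf gt gradg x Q).

Lemma run_in t : (1 <= t)%N -> X0 (x t).
Proof.
case: t => [//|[_|t _]]; first exact: run_x1 run.
by have [] := run_x run (isT : 1 <= t.+1)%N.
Qed.

Lemma queue_ge0 t k : (1 <= t)%N -> 0 <= Q t 0 k.
Proof.
case: t => [//|[_|t _]]; first by rewrite (run_Q1 run) mxE.
by rewrite (run_Q run)// le_max lexx orbT.
Qed.

(** Collecting the gradients turns the objective of a round into a single linear
    form plus the proximal term, the shape of [minimizer_three_points]. *)
Let step_gradient t : 'rV[R]_n :=
  V *: gradf t (x t) + \sum_k Q t 0 k *: gradg t k (x t).

Let dotp_step_gradient t y : dotp (step_gradient t) y =
  V * dotp (gradf t (x t)) y + \sum_k Q t 0 k * dotp (gradg t k (x t)) y.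
Proof.
rewrite dotpDl dotpZl dotp_suml; congr (_ + _).
by apply: eq_bigr => k _; rewrite dotpZl.
Qed.

Let run_minimizer t : (1 <= t)%N -> is_minimizer X0
  (fun y => dotp (step_gradient t) (y - x t) + alpha * enorm (y - x t) ^+ 2)
  (x t.+1).
Proof.
move=> t1; have [X0x xmin] := run_x run t1; split=> // y X0y.
by rewrite !dotp_step_gradient; exact: xmin.
Qed.

Lemma step_length t : (1 <= t)%N ->
  alpha * enorm (x t.+1 - x t) <= V * D1 + D2 * \sum_k Q t 0 k.
Proof.
move=> t1; have X0x := run_in t1.
apply: le_trans (minimizer_step_length X0x (run_minimizer t1)) _.
rewrite (le_trans (enormD _ _))// enormZ// lerD//.
  by rewrite ler_wpM2l// gradf_le.
rewrite (le_trans (enorm_sum _))// mulr_sumr ler_sum// => k _.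
by rewrite enormZ ?queue_ge0// mulrC ler_wpM2r ?queue_ge0 ?gradg_le.
Qed.

(** The queue dominates the sum of the linearized constraints, and linearizing
    at [x t] instead of evaluating there costs at most [D2] times the step. *)
Lemma constraint_sum_le T k :
  \sum_(1 <= t < T.+1) gt t k (x t) <=
  Q T.+1 0 k + D2 * \sum_(1 <= t < T.+1) enorm (x t.+1 - x t).
Proof.
elim: T => [|T IH].
  by rewrite !big_geq// mulr0 addr0 queue_ge0.
rewrite big_nat_recr//= [X in D2 * X]big_nat_recr//= (run_Q run)// mulrDr.
have X0x : X0 (x T.+1) by exact: run_in.
have := dotp_le (- gradg T.+1 k (x T.+1)) (x T.+2 - x T.+1).
rewrite dotpNl enormN => dle.
have := ler_wpM2r (enorm_ge0 (x T.+2 - x T.+1)) (@gradg_le T.+1 k _ isT X0x).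
set q := _ + dotp _ _; have : q <= Num.max q 0 by rewrite le_max lexx.
by rewrite /q; lra.
Qed.

(** Squaring the queue update produces
    [2 sum_k Q_k (g_k(x) + <grad g_k, step>)].  [minimizer_three_points] moves
    this linearization from the next iterate to [z], where convexity bounds it
    by [g_k(z)], and pays with the change of the distance term. *)
Lemma lyapunov_step t z : (1 <= t)%N -> X0 z ->
  enorm (Q t.+1) ^+ 2 + 2 * alpha * enorm (x t.+1 - z) ^+ 2 <=
  enorm (Q t) ^+ 2 + 2 * alpha * enorm (x t - z) ^+ 2
  + 2 * \sum_k Q t 0 k * gt t k z
  + (2 * V * D1 * Rad + m%:R * (G + D2 * Rad) ^+ 2).
Proof.
move=> t1 X0z; have X0x := run_in t1; have X0x' := @run_in t.+1 isT.
set delta := x t.+1 - x t.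
pose a k := gt t k (x t) + dotp (gradg t k (x t)) delta.
have Q' : enorm (Q t.+1) ^+ 2 <= \sum_k (Q t 0 k + a k) ^+ 2.
  rewrite enorm_sqr; apply: ler_sum => k _; rewrite (run_Q run)// -expr2 -addrA.
  rewrite -/delta -/(a k); have [q0|//] := leP (Q t 0 k + a k) 0.
  by rewrite expr0n sqr_ge0.
have sqE : \sum_k (Q t 0 k + a k) ^+ 2 =
    enorm (Q t) ^+ 2 + 2 * \sum_k Q t 0 k * a k + \sum_k a k ^+ 2.
  rewrite enorm_sqr mulr_sumr -!big_split; apply: eq_bigr => k _ /=; ring.
have a2 : \sum_k a k ^+ 2 <= m%:R * (G + D2 * Rad) ^+ 2.
  rewrite mulr_natl -[X in _ *+ X](card_ord m) -sumr_const.
  apply: ler_sum => k _.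
  have ale : `|a k| <= G + D2 * Rad.
    rewrite (le_trans (ler_normD _ _))// lerD ?gt_le//.
    rewrite (le_trans (dotp_norm_le _ _))//.
    by rewrite ler_pM ?enorm_ge0 ?gradg_le ?diam_le.
  rewrite -(real_normK (num_real (a k))) lerXn2r ?nnegrE//.
  exact: le_trans (normr_ge0 _) ale.
have := minimizer_three_points convX0 alpha_ge0 (run_minimizer t1) X0z.
rewrite !dotp_step_gradient -/delta.
(* Convexity: a linearization lies below the function, and the weights
   [Q t 0 k] are nonnegative. *)
have suba : \sum_k Q t 0 k * a k <= \sum_k Q t 0 k * gt t k z +
   (\sum_k Q t 0 k * dotp (gradg t k (x t)) delta
   - \sum_k Q t 0 k * dotp (gradg t k (x t)) (z - x t)).
  rewrite -sumrB -big_split; apply: ler_sum => k _ /=.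
  rewrite -mulrBr -mulrDr ler_wpM2l ?queue_ge0//.
  by have := @gradg_sub t k _ t1 X0x _ X0z; rewrite /a; lra.
have fle :
    dotp (gradf t (x t)) (z - x t) - dotp (gradf t (x t)) delta <= D1 * Rad.
  rewrite -dotpNr -dotpDr /delta opprB addrA subrK.
  by rewrite (le_trans (dotp_le _ _))// ler_pM ?enorm_ge0 ?gradf_le ?diam_le.
have := ler_wpM2l V_ge0 fle.
have : 0 <= alpha * enorm delta ^+ 2 by rewrite mulr_ge0 ?sqr_ge0.
lra.
Qed.

End algorithm_run.

Section lyapunov.
Context {R : realType} {n m : nat} (a : R).
Implicit Types (q : 'rV[R]_m) (x z : 'rV[R]_n).

(** Including the scaled distance to [z] in the potential absorbs the terms
    [alpha |x - z|^2] of [minimizer_three_points] round by round. *)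
Definition lyapunov z q x : R :=
  Num.sqrt (enorm q ^+ 2 + 2 * a * enorm (x - z) ^+ 2).

Context (a_ge0 : 0 <= a).

Lemma lyapunov_ge0 z q x : 0 <= lyapunov z q x.
Proof. exact: sqrtr_ge0. Qed.

Lemma lyapunov_sqr z q x :
  lyapunov z q x ^+ 2 = enorm q ^+ 2 + 2 * a * enorm (x - z) ^+ 2.
Proof.
rewrite sqr_sqrtr//; apply: addr_ge0; first exact: sqr_ge0.
by apply: mulr_ge0; rewrite ?sqr_ge0// mulr_ge0.
Qed.

Lemma enorm_le_lyapunov z q x : enorm q <= lyapunov z q x.
Proof.
rewrite -(@ler_pXn2r _ 2) ?nnegrE ?enorm_ge0 ?lyapunov_ge0// lyapunov_sqr.
by rewrite lerDl; apply: mulr_ge0; rewrite ?sqr_ge0// mulr_ge0.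
Qed.

Lemma lyapunov0_le z x (Rad w K : R) : a = w ^+ 2 -> 0 <= w -> 0 <= Rad ->
  4 * Rad <= K -> enorm (x - z) <= Rad -> lyapunov z 0 x <= K * w.
Proof.
move=> aw w0 Rad0 RK xz; have e0 := enorm_ge0 (x - z).
have xz2 : enorm (x - z) ^+ 2 <= Rad ^+ 2 by rewrite lerXn2r ?nnegrE.
have K2 : (4 * Rad) ^+ 2 <= K ^+ 2 by rewrite lerXn2r ?nnegrE//; lra.
rewrite -(@ler_pXn2r _ 2) ?nnegrE ?lyapunov_ge0 ?mulr_ge0//; last by lra.
rewrite lyapunov_sqr enorm0 expr0n /= add0r aw exprMn -mulrA mulrCA mulrC.
rewrite ler_wpM2r ?sqr_ge0//; have := sqr_ge0 Rad; lra.
Qed.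

(** With [a = w^2] the distance part of the square is at most
    [2 (w Rad)^2 <= (K w)^2 / 8]; above the level [K w] the queue part makes up
    the remaining [7 / 8] of the square, hence [|q| >= Y / 2]. *)
Lemma lyapunov_le_sum z q x (Rad w K : R) : a = w ^+ 2 -> 0 <= w -> 0 <= Rad ->
  4 * Rad <= K -> enorm (x - z) <= Rad -> (forall k, 0 <= q 0 k) ->
  K * w <= lyapunov z q x -> lyapunov z q x <= 2 * \sum_k q 0 k.
Proof.
move=> aw w0 Rad0 RK xz q0 KY.
apply: (@le_trans _ _ (2 * enorm q)); last by rewrite ler_wpM2l ?enorm_le_sum.
rewrite -(@ler_pXn2r _ 2) ?nnegrE ?lyapunov_ge0 ?mulr_ge0 ?enorm_ge0//.
have xz2 : enorm (x - z) ^+ 2 <= Rad ^+ 2.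
  by rewrite lerXn2r ?nnegrE ?enorm_ge0.
have K2 : (4 * Rad) ^+ 2 <= K ^+ 2 by rewrite lerXn2r ?nnegrE//; lra.
have Y2 : (K * w) ^+ 2 <= lyapunov z q x ^+ 2.
  by rewrite lerXn2r ?nnegrE ?lyapunov_ge0// mulr_ge0//; lra.
have : w ^+ 2 * enorm (x - z) ^+ 2 <= w ^+ 2 * (K ^+ 2 / 16).
  by rewrite ler_wpM2l ?sqr_ge0//; lra.
move: Y2; rewrite exprMn lyapunov_sqr aw exprMn => Y2 h.
have := sqr_ge0 (enorm q).
have := mulr_ge0 (sqr_ge0 w) (sqr_ge0 (enorm (x - z))).
lra.
Qed.

End lyapunov.

(** * Integrals *)

Lemma Rintegral_probability_cst d (T : measurableType d) (R : realType)
    (P : probability T R) (a : R) : \int[P]_(x in setT) a = a.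
Proof.
rewrite Rintegral_cst// -[RHS]mulr1; congr (_ * _).
transitivity (fine (1%:E : \bar R)) => //.
by congr fine; exact: probability_setT.
Qed.

Lemma integrable_Rsum d (T : measurableType d) (R : realType)
    (mu : {measure set T -> \bar R}) (I : Type) (s : seq I) (F : I -> T -> R) :
  (forall i, mu.-integrable setT (EFin \o F i)) ->
  mu.-integrable setT (EFin \o (fun x => \sum_(i <- s) F i x)).
Proof.
move=> iF; rewrite (_ : EFin \o _ = (fun x => \sum_(i <- s) (EFin \o F i) x)%E).
  exact: integrable_sum.
by apply/funext => x /=; rewrite sumEFin.
Qed.

Lemma Rintegral_sum d (T : measurableType d) (R : realType)
    (mu : {measure set T -> \bar R}) (I : Type) (s : seq I) (F : I -> T -> R) :
  (forall i, mu.-integrable setT (EFin \o F i)) ->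
  \int[mu]_x (\sum_(i <- s) F i x) = \sum_(i <- s) \int[mu]_x F i x.
Proof.
move=> iF; elim: s => [|i s IH].
  rewrite big_nil; under eq_Rintegral do rewrite big_nil.
  by rewrite Rintegral_cst// mul0r.
rewrite big_cons -IH; under eq_Rintegral do rewrite big_cons.
by rewrite RintegralD//; exact: integrable_Rsum.
Qed.

(** The integral of a nonnegative function is a supremum over the simple
    functions below it, hence monotone for arbitrary functions.  This is what
    bounds the expectation of [s |-> g k (x t s) (omega t s)], a function whose
    measurability would have to be derived from the continuity of [g k] in its
    first argument. *)
Lemma le_integral_of_ge0_bound d (T : measurableType d) (R : realType)
    (mu : {measure set T -> \bar R}) (f g : T -> \bar R) :
  (forall s, 0 <= g s)%E -> (forall s, f s <= g s)%E ->
  (\int[mu]_s f s <= \int[mu]_s g s)%E.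
Proof.
move=> g0 fg; rewrite integralE.
apply: (@le_trans _ _ (\int[mu]_s f^\+ s)%E).
  by rewrite geeDl// leeNl oppe0 integral_ge0.
rewrite !ge0_integralTE//; apply: le_ereal_sup => _ [h hf <-].
exists h => // s; apply: le_trans (hf s) _.
by rewrite funeposE ge_max fg g0.
Qed.

(** * Independence of past and fresh samples *)

Section independence.
Context {R : realType} {d d' : measure_display}.
Context {S : measurableType d} {Om : measurableType d'}.
Context {P : probability S R}.
Implicit Type omega : nat -> {RV P >-> Om}.

(** A pi-system generating [samples_sigma omega t], on which the product rule is
    the definition of mutual independence. *)
Definition cylinders omega (t : nat) : set (set S) :=
  [set E | exists2 B : nat -> set Om, (forall i, measurable (B i)) &
     E = \bigcap_(i in [set` iota 1 t]) (omega i @^-1` B i)].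

Lemma cylinders_setI omega t : setI_closed (cylinders omega t).
Proof.
move=> _ _ [A mA ->] [B mB ->]; exists (fun i => A i `&` B i).
  by move=> i; exact: measurableI.
by rewrite -bigcapI; apply: eq_bigcapr => i _; rewrite preimage_setI.
Qed.

Lemma cylinders_measurable omega t : cylinders omega t `<=` measurable.
Proof.
move=> _ [B mB ->]; apply: fin_bigcap_measurable => // i _.
by rewrite -[X in measurable X]setTI; exact: measurable_funP.
Qed.

Lemma samples_sigma_cylinders omega t :
  samples_sigma omega t `<=` <<s cylinders omega t >>.
Proof.
apply: sub_smallest2r; first exact: smallest_sigma_algebra.
elim/big_ind : _ => [//|X Y XC YC|i _].
- by rewrite subUset.
- move=> E [A mA <-].
  exists (fun j => if j == i.+1 then A else setT) => [j|]; first by case: ifP.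
  rewrite setTI; apply/seteqP; split=> [s As j _ /=|s /(_ i.+1)].
    by case: eqVneq => [->|].
  by rewrite /= eqxx mem_iota /= add1n ltnS; apply; apply: ltn_ord.
Qed.

(** For fixed [B], both sides are finite measures in [E]; they agree on the
    cylinders, hence on the sigma-algebra that these generate. *)
Lemma indep_samples_sigma omega t E B : mutually_independent omega ->
  samples_sigma omega t E -> measurable B ->
  (P (E `&` omega t.+1 @^-1` B) = P E * P (omega t.+1 @^-1` B))%E.
Proof.
move=> ind tE mB.
have mF : measurable (omega t.+1 @^-1` B).
  by rewrite -[X in measurable X]setTI; exact: measurable_funP.
have PF : P (omega t.+1 @^-1` B) \is a fin_num by exact: fin_num_measure.
have F0 : 0 <= fine (P (omega t.+1 @^-1` B)) by exact: fine_ge0.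
pose p : {nonneg R} := NngNum F0.
have pE : (p%:num)%:E = P (omega t.+1 @^-1` B) by rewrite /= fineK.
have : mrestr P mF E = mscale p P E.
  apply: (@g_sigma_algebra_measure_unique _ _ _ (cylinders omega t)
    (@cylinders_measurable _ _) (fun=> setT)) => //.
  - by move=> _; exists (fun=> setT) => //; rewrite bigcapT.
  - by rewrite bigcup_const//; exists 0%N.
  - exact: cylinders_setI.
  - move=> _ [A mA ->]; rewrite /= /mrestr /mscale pE.
    (* A cylinder intersected with the event on the sample [t.+1] is a cylinder
       over one more index. *)
    pose A' i := if i == t.+1 then B else A i.
    have mA' i : measurable (A' i) by rewrite /A'; case: ifP.
    have A'E i : i \in iota 1 t -> A' i = A i.
      rewrite mem_iota add1n ltnS /A'.
      by case: eqP => [->|//]; rewrite ltnn andbF.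
    have ut : uniq (t.+1 :: iota 1 t).
      by rewrite /= iota_uniq mem_iota add1n ltnn andbF.
    have gt0 i : i \in t.+1 :: iota 1 t -> (1 <= i)%N.
      by rewrite inE mem_iota => /predU1P[->|/andP[]].
    have := ind _ A' ut gt0 mA'.
    rewrite bigcap_seq !big_cons setIC.
    rewrite (_ : A' t.+1 = B); last by rewrite /A' eqxx.
    rewrite (eq_big_seq (fun i => omega i @^-1` A i)); last first.
      by move=> i it; rewrite A'E.
    rewrite [X in _ = (_ * X)%E -> _](eq_big_seq
      (fun i => P (omega i @^-1` A i))%E); last by move=> i it; rewrite A'E.
    rewrite -bigcap_seq => ->; congr (_ * _)%E; apply/esym/ind => //.
      by rewrite iota_uniq.
    by move=> i it; apply: gt0; rewrite inE it orbT.
  - by move=> _; rewrite /= /mrestr setTI -ge0_fin_numE.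
  - exact: samples_sigma_cylinders.
by rewrite /mrestr /mscale pE muleC.
Qed.

Lemma samples_sigma_measurable omega t : samples_sigma omega t `<=` measurable.
Proof.
move=> E /samples_sigma_cylinders; apply: smallest_sub => //.
  exact: sigma_algebra_measurable.
exact: cylinders_measurable.
Qed.

(** The sample space with the sigma-algebra [samples_sigma omega t], as a
    measurable type: being a function of the first [t] samples becomes ordinary
    measurability, for which closure lemmas are available. *)
Definition past omega t : measurableType _ :=
  g_sigma_algebraType (\big[setU/set0]_(i < t)
    preimage_set_system setT (omega i.+1) measurable).

Lemma past_measurable omega t d2 (T2 : measurableType d2) (A : S -> T2) :
  measurable_fun [set: past omega t] A -> measurable_fun [set: S] A.
Proof.
move=> mA _ B mB; apply: (@samples_sigma_measurable omega t).
exact: mA measurableT B mB.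
Qed.

(** The joint law of [A] and [omega t.+1] is a product measure, so the
    expectation of the product splits by Tonelli's theorem. *)
Lemma indep_ge0_integralM omega t (mu : probability Om R) (A : S -> R)
    (h : Om -> R) : iid_samples mu omega ->
  measurable_fun [set: past omega t] A ->
  (forall s, 0 <= A s) ->
  measurable_fun setT h -> (forall w, 0 <= h w) ->
  (\int[P]_s (A s * h (omega t.+1 s))%:E =
   \int[P]_s (A s)%:E * \int[mu]_w (h w)%:E)%E.
Proof.
move=> [ind law] tA A0 mh h0.
have mA : measurable_fun [set: S] A by exact: past_measurable tA.
have mZ : measurable_fun setT (fun s => (A s, omega t.+1 s)).
  exact: measurable_fun_pair.
pose X : {RV P >-> R} := mfun_Sub (mem_set mA).
pose Z : {RV P >-> (R * Om)%type} := mfun_Sub (mem_set mZ).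
(* [A] is nonnegative; the absolute value makes the integrand nonnegative on
   the whole plane. *)
pose f (z : (R * Om)%type) : \bar R := (`|z.1| * h z.2)%:E.
have mf : measurable_fun (setT : set (R * Om)%type) f.
  apply/measurable_EFinP; apply: measurable_funM.
    exact: measurableT_comp.
  exact: measurableT_comp.
have f0 z : (0 <= f z)%E by rewrite lee_fin mulr_ge0.
transitivity (\int[distribution P Z]_z f z)%E.
  rewrite ge0_integral_distribution//; apply: eq_integral => s _ /=.
  by rewrite /f /= ger0_norm.
transitivity (\int[distribution P X \x mu]_z f z)%E.
  apply: eq_measure_integral => /= E mE _; apply/esym.
  apply: (@product_measure_unique _ _ _ _ _ (distribution P X) mu
    (distribution P Z)) => // B C mB mC.
  have tAB : samples_sigma omega t (A @^-1` B).
    by rewrite -[X in samples_sigma _ _ X]setTI; exact: tA measurableT B mB.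
  rewrite [LHS](indep_samples_sigma ind tAB mC).
  by congr (_ * _)%E; exact: law.
rewrite fubini_tonelli1// /fubini_F /f /=.
transitivity (\int[distribution P X]_x (`|x|%:E * \int[mu]_w (h w)%:E))%E.
  apply: eq_integral => x _; under eq_integral do rewrite EFinM.
  rewrite ge0_integralZl//; first exact/measurable_EFinP.
  by move=> w _; rewrite lee_fin.
rewrite ge0_integralZr//; last 2 first.
- exact/measurable_EFinP.
- by apply: integral_ge0 => w _; rewrite lee_fin.
congr (_ * _)%E; rewrite ge0_integral_distribution//.
  by apply: eq_integral => s _ /=; rewrite ger0_norm.
exact/measurable_EFinP.
Qed.

(** The form in which the Slater condition is used: against a nonnegative weight
    known before round [t.+1], the fresh sample contributes its mean.  Shifting
    [h] by its bound [G] reduces the claim to nonnegative functions. *)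
Lemma samples_mean_le omega t (mu : probability Om R) (A : S -> R)
    (h : Om -> R) (G c : R) : iid_samples mu omega ->
  measurable_fun [set: past omega t] A ->
  (forall s, 0 <= A s) -> P.-integrable setT (EFin \o A) ->
  measurable_fun setT h -> (forall w, `|h w| <= G) ->
  ('E_mu[h] <= c%:E)%E ->
  P.-integrable setT (EFin \o (fun s => A s * h (omega t.+1 s))) /\
  \int[P]_s (A s * h (omega t.+1 s)) <= c * \int[P]_s A s.
Proof.
move=> iid tA A0 iA mh hG; rewrite unlock => Eh.
have mA : measurable_fun [set: S] A by exact: past_measurable tA.
have mho : measurable_fun setT (h \o omega t.+1) by exact: measurableT_comp.
have ih : mu.-integrable setT (EFin \o h).
  apply: measurable_bounded_integrable => //.
    exact: (le_lt_trans (probability_le1 mu measurableT) (ltry 1)).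
  exists G; split => [|M GM w _ /=]; first exact: num_real.
  exact/ltW/(le_lt_trans _ GM).
have iG : mu.-integrable setT (EFin \o (fun=> G)).
  exact: finite_measure_integrable_cst.
have iGA : P.-integrable setT (EFin \o (fun s => G * A s)).
  exact: (@integrableZl _ _ _ P _ measurableT G _ iA).
have iAh : P.-integrable setT (EFin \o (fun s => A s * h (omega t.+1 s))).
  apply: (le_integrable measurableT _ _ iGA).
    by apply/measurable_EFinP; exact: measurable_funM.
  move=> s _ /=; rewrite lee_fin !normrM (ger0_norm (A0 s)) mulrC.
  by rewrite ler_wpM2r// (le_trans (hG _))// ler_norm.
split=> //.
have key : \int[P]_s (A s * (h (omega t.+1 s) + G)) =
    \int[P]_s A s * \int[mu]_w (h w + G).
  rewrite -fineM; last 2 first.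
  - exact: integrable_fin_num.
  - by apply: integrable_fin_num => //; exact: (integrableD measurableT ih iG).
  congr fine.
  apply: (@indep_ge0_integralM omega t mu A (fun w => h w + G)) => //.
    exact: measurable_funD.
  by move=> w; have := hG w; rewrite ler_norml => /andP[]; lra.
have : \int[P]_s (A s * (h (omega t.+1 s) + G)) =
    \int[P]_s (A s * h (omega t.+1 s)) + G * \int[P]_s A s.
  under eq_Rintegral do rewrite mulrDr (mulrC _ G).
  by rewrite RintegralD// RintegralZl.
rewrite key RintegralD// Rintegral_probability_cst.
have hc : \int[mu]_w h w <= c.
  by rewrite -lee_fin /Rintegral fineK//; exact: integrable_fin_num.
rewrite mulrDr [X in _ + X]mulrC => /addIr <-.
by rewrite mulrC ler_wpM2r// Rintegral_ge0.
Qed.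

End independence.

Lemma past_sq_dist (R : realType) (d d' : measure_display)
    (S : measurableType d) (Om : measurableType d') (P : probability S R)
    (omega : nat -> {RV P >-> Om}) t n (X : S -> 'rV[R]_n) (z : 'rV[R]_n) :
  samples_measurable omega t X ->
  measurable_fun [set: past omega t] (fun s => enorm (X s - z) ^+ 2).
Proof.
move=> mX.
have pX i : measurable_fun [set: past omega t] (fun s => X s 0 i).
  by move=> _ B mB; rewrite setTI; exact: mX.
rewrite (_ : (fun _ => _) = fun s => \sum_i (X s 0 i - z 0 i) ^+ 2).
  apply: measurable_sum => i; apply: measurable_funX.
  exact: (@measurable_funB _ _ _ _ _ (cst (z 0 i))).
apply/funext => s; rewrite enorm_sqr; apply: eq_bigr => i _.
by rewrite !mxE expr2.
Qed.

(** * Exponential drift *)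

(** From [exp (- y) >= 1 - y] one gets [exp y <= 1 / (1 - y)], and
    [(1 - y) (1 + y + 2 y^2) = 1 + y^2 (1 - 2 y) >= 1]. *)
Lemma expR_le_quadratic (R : realType) (y : R) :
  y <= 1 / 2 -> expR y <= 1 + y + 2 * y ^+ 2.
Proof.
move=> y12; have y1 : 0 < 1 - y by lra.
have := expR_ge1Dx (- y); rewrite expRN => h.
have e0 := expR_gt0 y.
have {h} : (1 - y) * expR y <= 1.
  by rewrite -ler_pdivlMr// div1r.
move=> h; rewrite -(ler_pM2l y1) (le_trans h)//.
have : 0 <= y ^+ 2 * (1 - 2 * y) by rewrite mulr_ge0 ?sqr_ge0//; lra.
lra.
Qed.

Section exponential_drift.
Context {R : realType} (r K L w : R).

(** The potential [exp (r (y - L w))] divided by [y], cut off below the level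
    [K w] at which the drift sets in.  Dividing by [y] makes it the factor in
    front of the increment of [y^2 / 2], up to the constant [r]. *)
Definition exp_weight (y : R) : R :=
  if K * w <= y then expR (r * (y - L * w)) / y else 0.

(** Above the level [K w], concavity of the square root gives
    [Y' <= Y + (u + c w) / Y], an increment bounded by [G + 1], and the
    exponential is expanded to second order; the error terms [c w / Y] and
    [2 r (G + 1)^2] are each at most [eps / 8].  Below that level
    [Y' <= L w], which accounts for the summand [1]. *)
Lemma exp_drift (G c eps Y Y' u : R) :
  0 < r -> 1 <= w -> 0 <= G -> 0 <= c -> 0 < K -> 0 <= Y -> 0 <= Y' ->
  K + G + c + 1 <= L -> c <= K -> c <= K * (eps / 8) ->
  r * (G + 1) <= 1 / 2 -> 2 * r * (G + 1) ^+ 2 <= eps / 8 ->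
  Y' ^+ 2 <= Y ^+ 2 + 2 * u + 2 * c * w -> `|u| <= G * Y ->
  expR (r * (Y' - L * w)) <=
  (1 + r * (eps / 4)) * (exp_weight Y * Y) + r * (exp_weight Y * u) + 1.
Proof.
move=> r0 w1 G0 c0 K0 Y0 Y'0 KL cK ceps rG rG2 step uG.
rewrite /exp_weight; case: ifPn => [KY|]; last first.
  rewrite -ltNge => YK; rewrite !(mul0r, mulr0) !add0r expR_le1.
  rewrite pmulr_rle0// subr_le0 -(@ler_pXn2r _ 2) ?nnegrE//; last first.
    rewrite mulr_ge0//; lra.
  rewrite (le_trans step)//.
  have KG : 0 <= G * (K * w - Y) by rewrite mulr_ge0//; lra.
  have LK : (K + G + c + 1) * w <= L * w by rewrite ler_wpM2r//; lra.
  have uY : u <= G * Y by rewrite (le_trans _ uG)// ler_norm.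
  have ww : c * w <= c * w ^+ 2 by rewrite ler_wpM2l// expr2; nra.
  have Y2 : Y ^+ 2 <= (K * w) ^+ 2 by rewrite lerXn2r ?nnegrE//; lra.
  have GKw : G * (K * w) <= G * K * w ^+ 2.
    by rewrite mulrA ler_wpM2l ?mulr_ge0//; nra.
  apply: (@le_trans _ _ (((K + G + c + 1) * w) ^+ 2)); last first.
    by rewrite lerXn2r ?nnegrE// mulr_ge0//; lra.
  have : 0 <= ((G + c + 1) ^+ 2 - 2 * c) * w ^+ 2.
    by rewrite mulr_ge0 ?sqr_ge0//; nra.
  have : 0 <= K * (c + 1) * w ^+ 2 by rewrite !mulr_ge0 ?sqr_ge0//; lra.
  lra.
have Ygt0 : 0 < Y by rewrite (lt_le_trans _ KY)// mulr_gt0//; lra.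
pose z := (u + c * w) / Y.
have zY : z * Y = u + c * w by rewrite divfK// gt_eqF.
have cwY : c * w <= eps / 8 * Y by nra.
have cwY1 : c * w <= Y by nra.
have Y'z : Y' <= Y + z.
  by rewrite -(ler_pM2r Ygt0) mulrDl zY; have := sqr_ge0 (Y' - Y); nra.
have zG : `|z| <= G + 1.
  rewrite -(ler_pM2r Ygt0) -{1}(gtr0_norm Ygt0) -normrM zY.
  rewrite (le_trans (ler_normD _ _))// mulrDl mul1r lerD// ger0_norm//.
  by rewrite mulr_ge0//; lra.
have rz : r * z <= 1 / 2.
  by rewrite (le_trans _ rG)// ler_pM2l// (le_trans _ zG)// ler_norm.
have z2 : z ^+ 2 <= (G + 1) ^+ 2.
  by rewrite -(real_normK (num_real z)) lerXn2r ?nnegrE//; lra.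
apply: (@le_trans _ _ (expR (r * (Y - L * w)) * expR (r * z))).
  by rewrite -expRD ler_expR -mulrDr ler_pM2l//; lra.
set e := expR (r * (Y - L * w)); have e0 : 0 < e by exact: expR_gt0.
apply: (@le_trans _ _ (e * (1 + r * z + 2 * (r * z) ^+ 2))).
  by rewrite ler_pM2l// expR_le_quadratic.
rewrite divfK ?gt_eqF//.
have -> : e / Y * u = e * (u / Y) by rewrite mulrAC mulrA.
have zE : z = u / Y + c * w / Y by rewrite -mulrDl.
have cw : c * w / Y <= eps / 8 by rewrite ler_pdivrMr.
suff : 1 + r * z + 2 * (r * z) ^+ 2 <= 1 + r * (eps / 4) + r * (u / Y).
  by move=> /(ler_wpM2l (ltW e0)); lra.
have rzE : r * z = r * (u / Y) + r * (c * w / Y) by rewrite zE mulrDr.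
rewrite exprMn.
have : r * (2 * r * z ^+ 2) <= r * (eps / 8).
  rewrite ler_pM2l// (le_trans _ rG2)// ler_pM2l// mulr_gt0//; lra.
have : r * (c * w / Y) <= r * (eps / 8) by rewrite ler_pM2l.
lra.
Qed.

End exponential_drift.

Section exponential_moment.
Context {R : realType} {d d' : measure_display}.
Context {S : measurableType d} {Om : measurableType d'}.
Context {P : probability S R} {mu : probability Om R}.
Context {omega : nat -> {RV P >-> Om}} (iid : iid_samples mu omega).
Context (r K L w G c eps : R).
Context (r0 : 0 < r) (w1 : 1 <= w) (G0 : 0 <= G) (c0 : 0 <= c) (K0 : 0 < K).
Context (KL : K + G + c + 1 <= L) (cK : c <= K) (eps0 : 0 < eps).
Context (ceps : c <= K * (eps / 8)).
Context (reps : r * eps <= 1).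
Context (rG : r * (G + 1) <= 1 / 2) (rG2 : 2 * r * (G + 1) ^+ 2 <= eps / 8).

Let w_gt0 : 0 < w. Proof. exact: lt_le_trans ltr01 w1. Qed.

Let Phi y := expR (r * (y - L * w)).
Let W y := exp_weight r K L w y.

Let measurable_Phi : measurable_fun setT Phi.
Proof.
apply: measurableT_comp => //; apply: measurable_funM => //.
exact: (@measurable_funB _ _ _ _ id (cst (L * w))).
Qed.

Lemma exp_weight_ge0 y : 0 <= y -> 0 <= W y.
Proof.
move=> y0; rewrite /W /exp_weight; case: ifP => // _.
by rewrite divr_ge0// expR_ge0.
Qed.

Lemma exp_weightM_le y : 0 <= y -> W y * y <= Phi y.
Proof.
move=> y0; rewrite /W /exp_weight; case: ifP => [Ky|_]; last first.
  by rewrite mul0r expR_ge0.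
by rewrite divfK// gt_eqF// (lt_le_trans _ Ky)// mulr_gt0.
Qed.

Lemma measurable_exp_weight : measurable_fun setT W.
Proof.
rewrite (_ : W = fun y => if K * w <= y then Phi y * y `^ (-1) else 0).
  apply: measurable_fun_ifT => //.
    exact: (@measurable_fun_ler _ _ _ _ (cst (K * w)) id).
  by apply: measurable_funM => //; exact: measurable_powR.
apply/funext => y; rewrite /W /exp_weight; case: ifP => // Ky.
by rewrite powR_inv1// (le_trans _ Ky)// mulr_ge0// ltW.
Qed.

(** Integrating [exp_drift].  By independence each weighted queue
    [exp_weight (Y s) * q k s] contributes at most [- eps] times its integral;
    as [Y <= 2 sum_k q k], the total gain is at least [eps / 2] times the
    integral of [exp_weight (Y s) * Y s], twice the loss [eps / 4] of
    [exp_drift]. *)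
Lemma exp_moment_step t m (Y Y' : S -> R) (q : 'I_m -> S -> R)
    (h : 'I_m -> Om -> R) :
  measurable_fun [set: past omega t] Y -> measurable_fun [set: S] Y' ->
  (forall k, measurable_fun [set: past omega t] (q k)) ->
  (forall k, measurable_fun [set: Om] (h k)) ->
  (forall s, 0 <= Y s) -> (forall s, 0 <= Y' s) ->
  (forall k s, 0 <= q k s <= Y s) ->
  (forall s, K * w <= Y s -> Y s <= 2 * \sum_k q k s) ->
  (forall k z, `|h k z| <= G) -> (forall k, 'E_mu[h k] <= (- eps)%:E)%E ->
  (forall s, `|\sum_k q k s * h k (omega t.+1 s)| <= G * Y s) ->
  (forall s, Y' s ^+ 2 <= Y s ^+ 2 + 2 * (\sum_k q k s * h k (omega t.+1 s))
     + 2 * c * w) ->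
  P.-integrable setT (EFin \o (Phi \o Y)) ->
  P.-integrable setT (EFin \o (Phi \o Y')) /\
  \int[P]_s Phi (Y' s) <= (1 - r * (eps / 4)) * \int[P]_s Phi (Y s) + 1.
Proof.
move=> pY mY' pq mh Y0 Y'0 qY Yq hG Eh uG step iPhi.
pose A k s := W (Y s) * q k s.
have pW : measurable_fun [set: past omega t] (W \o Y).
  by apply: measurableT_comp => //; exact: measurable_exp_weight.
have pA k : measurable_fun [set: past omega t] (A k) by exact: measurable_funM.
have A0 k s : 0 <= A k s.
  by have /andP[q0 _] := qY k s; rewrite mulr_ge0// exp_weight_ge0.
have iWY : P.-integrable setT (EFin \o (fun s => W (Y s) * Y s)).
  apply: (le_integrable measurableT _ _ iPhi).
    apply/measurable_EFinP; apply: measurable_funM.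
      exact: past_measurable pW.
    exact: past_measurable pY.
  move=> s _ /=; rewrite lee_fin !ger0_norm ?expR_ge0 ?exp_weightM_le//.
  by rewrite mulr_ge0 ?exp_weight_ge0.
have iA k : P.-integrable setT (EFin \o A k).
  apply: (le_integrable measurableT _ _ iWY).
    by apply/measurable_EFinP; exact: past_measurable (pA k).
  move=> s _ /=; have /andP[q0 qYs] := qY k s; rewrite lee_fin !ger0_norm//.
    by rewrite ler_wpM2l ?exp_weight_ge0.
  by rewrite mulr_ge0 ?exp_weight_ge0.
have meanA k := samples_mean_le iid (pA k) (A0 k) (iA k) (mh k) (hG k) (Eh k).
pose B k s := A k s * h k (omega t.+1 s).
have iB k : P.-integrable setT (EFin \o B k) := (meanA k).1.
have EB k : \int[P]_s B k s <= - eps * \int[P]_s A k s := (meanA k).2.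
pose a := 1 + r * (eps / 4).
have iaWY : P.-integrable setT (EFin \o (fun s => a * (W (Y s) * Y s))).
  exact: (@integrableZl _ _ _ P _ measurableT a _ iWY).
have isB : P.-integrable setT (EFin \o (fun s => \sum_k B k s)).
  exact: integrable_Rsum.
have irB : P.-integrable setT (EFin \o (fun s => r * \sum_k B k s)).
  exact: (@integrableZl _ _ _ P _ measurableT r _ isB).
have i1 : P.-integrable setT (EFin \o (fun=> 1)).
  exact: finite_measure_integrable_cst.
have i2 : P.-integrable setT
    (EFin \o (fun s => a * (W (Y s) * Y s) + r * \sum_k B k s)).
  exact: (integrableD measurableT iaWY irB).
have i3 : P.-integrable setT
    (EFin \o (fun s => a * (W (Y s) * Y s) + r * (\sum_k B k s) + 1)).
  exact: (integrableD measurableT i2 i1).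
have le3 s : Phi (Y' s) <= a * (W (Y s) * Y s) + r * (\sum_k B k s) + 1.
  have -> : \sum_k B k s = W (Y s) * \sum_k q k s * h k (omega t.+1 s).
    by rewrite mulr_sumr; apply: eq_bigr => k _; rewrite /B /A mulrA.
  exact: (@exp_drift R r K L w G c eps).
have iPhi' : P.-integrable setT (EFin \o (Phi \o Y')).
  apply: (le_integrable measurableT _ _ i3).
    by apply/measurable_EFinP; exact: measurableT_comp.
  move=> s _ /=; rewrite lee_fin ger0_norm ?expR_ge0// (le_trans (le3 s))//.
  exact: ler_norm.
split=> //.
apply: le_trans (le_Rintegral measurableT iPhi' i3 (fun s _ => le3 s)) _.
rewrite RintegralD// Rintegral_probability_cst.
rewrite RintegralD// !RintegralZl// Rintegral_sum//.
have sumB : \sum_k \int[P]_s B k s <= - eps * \sum_k \int[P]_s A k s.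
  by rewrite mulr_sumr; exact: ler_sum.
have sumA : 1 / 2 * \int[P]_s (W (Y s) * Y s) <= \sum_k \int[P]_s A k s.
  rewrite -Rintegral_sum// -RintegralZl//; apply: le_Rintegral => //.
  - exact: (@integrableZl _ _ _ P _ measurableT (1 / 2) _ iWY).
  - exact: integrable_Rsum.
  move=> s _; rewrite -mulr_sumr mulrCA.
  rewrite /W /exp_weight; case: ifPn => [/Yq Ys|]; last by rewrite !mul0r.
  by rewrite ler_wpM2l ?divr_ge0 ?expR_ge0//; lra.
have WPhi : \int[P]_s (W (Y s) * Y s) <= \int[P]_s Phi (Y s).
  by apply: le_Rintegral => // s _; exact: exp_weightM_le.
have lossA := ler_wpM2l (ltW (mulr_gt0 r0 eps0)) sumA.
have lossB := ler_wpM2l (ltW r0) sumB.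
have r4 : 0 <= 1 - r * (eps / 4) by have := reps; lra.
have := ler_wpM2l r4 WPhi; rewrite /a; lra.
Qed.

(** [4 / (r eps)] is the fixed point of the affine recursion of
    [exp_moment_step], and [y <= exp y] turns the bound on the exponential
    moment into a bound on the mean. *)
Lemma drift_mean_bound m (Y : nat -> S -> R) (q : nat -> 'I_m -> S -> R)
    (h : 'I_m -> Om -> R) :
  (forall t, measurable_fun [set: past omega t] (Y t.+1)) ->
  (forall t k, measurable_fun [set: past omega t] (q t.+1 k)) ->
  (forall k, measurable_fun [set: Om] (h k)) ->
  (forall t s, 0 <= Y t.+1 s) ->
  (forall t k s, 0 <= q t.+1 k s <= Y t.+1 s) ->
  (forall t s, K * w <= Y t.+1 s -> Y t.+1 s <= 2 * \sum_k q t.+1 k s) ->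
  (forall k z, `|h k z| <= G) -> (forall k, 'E_mu[h k] <= (- eps)%:E)%E ->
  (forall t s, `|\sum_k q t.+1 k s * h k (omega t.+1 s)| <= G * Y t.+1 s) ->
  (forall t s, Y t.+2 s ^+ 2 <= Y t.+1 s ^+ 2
     + 2 * (\sum_k q t.+1 k s * h k (omega t.+1 s)) + 2 * c * w) ->
  (forall s, Y 1%N s <= L * w) ->
  forall t, P.-integrable setT (EFin \o Y t.+1) /\
    \int[P]_s Y t.+1 s <= L * w + 4 / (r ^+ 2 * eps).
Proof.
move=> pY pq mh Y0 qY Yq hG Eh uG step Y1 t.
have mY j : measurable_fun [set: S] (Y j.+1) := past_measurable (pY j).
have r_neq0 : r != 0 by rewrite gt_eqF.
have eps_neq0 : eps != 0 by rewrite gt_eqF.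
have i1 a : P.-integrable setT (EFin \o (fun=> a)).
  exact: finite_measure_integrable_cst.
have [iPhi Phi_le] : P.-integrable setT (EFin \o (Phi \o Y t.+1)) /\
    \int[P]_s Phi (Y t.+1 s) <= 4 / (r * eps).
  elim: t => [|t [iPhi IH]].
    have Phi1 s : Phi (Y 1%N s) <= 1.
      by rewrite expR_le1 pmulr_rle0// subr_le0.
    have iPhi : P.-integrable setT (EFin \o (Phi \o Y 1%N)).
      apply: (le_integrable measurableT _ _ (i1 1)).
        by apply/measurable_EFinP; exact: measurableT_comp.
      by move=> s _ /=; rewrite lee_fin !ger0_norm ?expR_ge0 ?ler01.
    split=> //; apply: (@le_trans _ _ 1).
      rewrite -[leRHS](Rintegral_probability_cst P 1).
      by apply: le_Rintegral => // s _; exact: Phi1.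
    by rewrite ler_pdivlMr ?mulr_gt0//; have := reps; lra.
  have [iPhi' le'] := @exp_moment_step t m (Y t.+1) (Y t.+2) (q t.+1) h
    (pY t) (mY t.+1) (pq t) mh (Y0 t) (Y0 t.+1) (qY t) (Yq t) hG Eh (uG t)
    (step t) iPhi.
  split=> //; apply: le_trans le' _.
  have r4 : 0 <= 1 - r * (eps / 4) by have := reps; lra.
  have := ler_wpM2l r4 IH; rewrite [leRHS](_ : _ = 4 / (r * eps) - 1).
    by lra.
  by field; rewrite ?r_neq0 ?eps_neq0.
have ir : P.-integrable setT (EFin \o (fun s => r^-1 * Phi (Y t.+1 s))).
  exact: (@integrableZl _ _ _ P _ measurableT r^-1 _ iPhi).
have i2 : P.-integrable setT (EFin \o (fun s => L * w + r^-1 * Phi (Y t.+1 s))).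
  exact: (integrableD measurableT (i1 _) ir).
have Yle s : Y t.+1 s <= L * w + r^-1 * Phi (Y t.+1 s).
  rewrite -lerBlDl -(ler_pM2l r0) mulVKf//.
  by have := expR_ge1Dx (r * (Y t.+1 s - L * w)); rewrite /Phi; lra.
have iY : P.-integrable setT (EFin \o Y t.+1).
  apply: (le_integrable measurableT _ _ i2); first exact/measurable_EFinP.
  by move=> s _ /=; rewrite lee_fin ger0_norm// (le_trans (Yle s))// ler_norm.
split=> //.
apply: le_trans (le_Rintegral measurableT iY i2 (fun s _ => Yle s)) _.
rewrite RintegralD// Rintegral_probability_cst lerD2l RintegralZl//.
have rV0 : 0 <= r^-1 by rewrite invr_ge0 ltW.
apply: le_trans (ler_wpM2l rV0 Phi_le) _.
rewrite le_eqVlt; apply/orP; left; apply/eqP.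
by field; rewrite ?r_neq0 ?eps_neq0.
Qed.

End exponential_moment.

(** The level [K] makes [c / K <= eps / 8] and dominates the diameter; the rate
    [r] is of order [eps / (G + 1)^2], small enough for the second-order error
    of the exponential. *)
Lemma drift_constants (R : realFieldType) (G c eps Rad : R) :
  0 <= G -> 0 <= c -> 0 < eps -> 0 <= Rad ->
  exists r K L : R,
    [/\ 0 < r, 0 < K, K + G + c + 1 <= L & c <= K] /\
    [/\ c <= K * (eps / 8), r * eps <= 1, r * (G + 1) <= 1 / 2,
        2 * r * (G + 1) ^+ 2 <= eps / 8 & 4 * Rad <= K].
Proof.
move=> G0 c0 eps0 Rad0.
pose D := eps ^+ 2 + 16 * (G + 1) ^+ 2.
have D0 : 0 < D by rewrite ltr_wpDr ?exprn_gt0// mulr_ge0 ?sqr_ge0.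
have ce : 0 <= c / eps by rewrite divr_ge0// ltW.
exists (eps / D), (1 + 4 * Rad + c + 8 * (c / eps)).
exists (1 + 4 * Rad + c + 8 * (c / eps) + G + c + 1).
have G2 := sqr_ge0 (G + 1); have e2 := sqr_ge0 eps.
split; split => //; try lra.
- by rewrite divr_gt0.
- have -> : (1 + 4 * Rad + c + 8 * (c / eps)) * (eps / 8) =
    (1 + 4 * Rad + c) * (eps / 8) + c by field; rewrite gt_eqF.
  by rewrite lerDr mulr_ge0//; lra.
- by rewrite mulrAC ler_pdivrMr// mul1r /D expr2; lra.
- rewrite mulrAC ler_pdivrMr// /D.
  have := sqr_ge0 (eps - (G + 1)); lra.
- rewrite (_ : 2 * (eps / D) * (G + 1) ^+ 2 =
    eps / 8 * (16 * (G + 1) ^+ 2 / D)).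
    by rewrite ler_piMr ?divr_ge0 ?ltW// ltr_pdivrMr// mul1r /D ltrDr exprn_gt0.
  by field; rewrite gt_eqF.
Qed.

(** * Expected constraint violation *)

Theorem theorem1 (R : realType) (m : nat) (D1 D2 G Rad eps : R)
    (hD1 : 0 < D1) (hD2 : 0 < D2) (hG : 0 < G) (hRad : 0 < Rad)
    (heps : 0 < eps) :
  exists C : R,
  forall (n : nat) (X0 : set 'rV[R]_n)
    (d d' : measure_display) (S : measurableType d) (Om : measurableType d')
    (P : probability S R) (mu : probability Om R)
    (omega : nat -> {RV P >-> Om})
    (f : nat -> S -> 'rV[R]_n -> R) (gradf : nat -> S -> 'rV[R]_n -> 'rV[R]_n)
    (g : 'I_m -> 'rV[R]_n -> Om -> R)
    (gradg : 'I_m -> 'rV[R]_n -> Om -> 'rV[R]_n)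
    (T : nat) (x : nat -> S -> 'rV[R]_n) (Q : nat -> S -> 'rV[R]_m),
    X0 !=set0 -> compact X0 -> convex_set X0 ->
    iid_samples mu omega ->
    (forall k y, X0 y -> measurable_fun [set: Om] (g k y)) ->
    (forall k w, convex_function X0 (fun y => g k y w)) ->
    (forall t s, (1 <= t)%N -> convex_function X0 (f t s)) ->
    (forall t, (1 <= t)%N -> determined_by_samples omega t X0 (f t)) ->
    basic_assumption X0 f gradf g gradg D1 D2 G Rad ->
    slater mu X0 g eps ->
    (1 <= T)%N ->
    (forall s, algorithm1_run (Num.sqrt T%:R) T%:R X0
       (fun t => gradf t s)
       (fun t k y => g k y (omega t s))
       (fun t k y => gradg k y (omega t s))
       (fun t => x t s) (fun t => Q t s)) ->
    (forall t, (1 <= t)%N -> samples_measurable omega t.-1 (x t)) ->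
    (forall t, (1 <= t)%N -> samples_measurable omega t.-1 (Q t)) ->
    forall k : 'I_m,
      ('E_P[fun s => (\sum_(1 <= t < T.+1) g k (x t s) (omega t s))%R]
         <= (C * Num.sqrt T%:R)%:E)%E.
Proof.
pose c := D1 * Rad + m%:R * (G + D2 * Rad) ^+ 2 / 2.
have c0 : 0 <= c.
  apply: addr_ge0; first by rewrite mulr_ge0// ltW.
  by rewrite divr_ge0// mulr_ge0 ?sqr_ge0.
have [r [K [L [[r0 K0 KL cK] [ceps reps rG rG2 RadK]]]]] :=
  drift_constants (ltW hG) c0 heps (ltW hRad).
have KL' : K <= L by lra.
(* [C1 * sqrt T] will bound the mean of the potential in every round. *)
pose C1 := L + 4 / (r ^+ 2 * eps).
exists (C1 + D2 * (D1 + D2 * (m%:R * C1))).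
move=> n X0 d d' S Om P mu omega f gradf g gradg T x Q _ _ convX0 iid mg _ _ _.
move=> basic [z X0z Ez] T1 run mx mQ k.
set w := Num.sqrt T%:R in run *.
have T0 : 0 < T%:R :> R by rewrite ltr0n.
have w2 : T%:R = w ^+ 2 by rewrite sqr_sqrtr// ltW.
have w1 : 1 <= w by rewrite -sqrtr1 ler_wsqrtr// ler1n.
have w0 : 0 < w by rewrite (lt_le_trans ltr01).
have g_le j y v : X0 y -> `|g j y v| <= G.
  move=> X0y; have := coord_enorm_le (\row_j g j y v) j.
  by rewrite mxE => /le_trans; apply; exact: g_bound basic _ _ X0y.
have in_X0 s t : (1 <= t)%N -> X0 (x t s).
  by move=> t1; exact: (run_in (run s) t1).
have Q0 s t j : (1 <= t)%N -> 0 <= Q t s 0 j.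
  by move=> t1; exact: (queue_ge0 (run s) j t1).
pose Y t s := lyapunov T%:R z (Q t s) (x t s).
have QY t j s : (1 <= t)%N -> 0 <= Q t s 0 j <= Y t s.
  move=> t1; rewrite Q0//= (le_trans (ler_norm _))//.
  by rewrite (le_trans (coord_enorm_le _ _))// enorm_le_lyapunov// ltW.
have pQ t j : measurable_fun [set: past omega t] (fun s => Q t.+1 s 0 j).
  by move=> _ B mB; rewrite setTI; exact: (mQ t.+1).
have pY t : measurable_fun [set: past omega t] (Y t.+1).
  apply: measurableT_comp.
    exact: continuous_measurable_fun (@sqrt_continuous R).
  apply: measurable_funD; last first.
    by apply: measurable_funM => //; apply: past_sq_dist; exact: (mx t.+1).
  rewrite (_ : (fun s => _) = fun s => enorm (Q t.+1 s - 0) ^+ 2).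
    by apply: past_sq_dist; exact: (mQ t.+1).
  by apply/funext => s; rewrite subr0.
have lyap t : P.-integrable setT (EFin \o Y t.+1) /\
    \int[P]_s Y t.+1 s <= L * w + 4 / (r ^+ 2 * eps).
  move: t; apply: (@drift_mean_bound _ _ _ _ _ P mu omega iid r K L w G c eps
    r0 w1 (ltW hG) c0 K0 KL cK heps ceps reps rG rG2 m Y
    (fun t j s => Q t s 0 j) (fun j => g j z)) => //.
  - by move=> j; exact: mg.
  - by move=> t s; exact: lyapunov_ge0.
  - by move=> t j s; exact: QY.
  - move=> t s.
    apply: (@lyapunov_le_sum _ _ _ _ _ _ _ _ Rad) => //; try exact: ltW.
      exact: diameter_bound basic _ _ (in_X0 s t.+1 isT) X0z.
    by move=> j; exact: Q0.
  - by move=> j v; exact: g_le.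
  - move=> t s.
    rewrite (_ : \sum_j _ = dotp (Q t.+1 s) (\row_j g j z (omega t.+1 s))).
      rewrite (le_trans (dotp_norm_le _ _))// mulrC ler_pM ?enorm_ge0//.
        exact: g_bound basic _ _ X0z.
      by rewrite enorm_le_lyapunov// ltW.
    by apply: eq_bigr => j _; rewrite mxE.
  - move=> t s; rewrite !lyapunov_sqr; try exact: ltW.
    have := @lyapunov_step _ _ _ w T%:R X0 (gradf^~ s) _ _ (x^~ s) (Q^~ s)
      D1 D2 G Rad convX0 (ltW w0) (ltW T0)
      (fun t' y t1 X0y => gradf_bound basic s t1 X0y)
      (fun t' j y _ X0y => gradg_subgradient basic j (omega t' s) X0y)
      (fun t' j y _ X0y => gradg_bound basic j (omega t' s) X0y)
      (fun t' j y _ => g_le j y (omega t' s))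
      (diameter_bound basic) (run s) t.+1 z isT X0z.
    move=> /le_trans; apply; rewrite lerD2l.
    have : m%:R * (G + D2 * Rad) ^+ 2 <= m%:R * (G + D2 * Rad) ^+ 2 * w.
      by rewrite ler_peMr// mulr_ge0 ?sqr_ge0.
    rewrite /c; lra.
  - move=> s; rewrite /Y (run_Q1 (run s)).
    apply: (@le_trans _ _ (K * w)); last by rewrite ler_wpM2r// ltW.
    apply: (@lyapunov0_le _ _ _ _ _ _ _ Rad) => //; try exact: ltW.
    exact: diameter_bound basic _ _ (in_X0 s 1%N isT) X0z.
have EY t : \int[P]_s Y t.+1 s <= C1 * w.
  apply: le_trans (lyap t).2 _.
  rewrite /C1 [leRHS]mulrDl lerD// ler_peMr// divr_ge0//.
  by rewrite mulr_ge0 ?sqr_ge0// ltW.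
have iY t : P.-integrable setT (EFin \o Y t.+1) := (lyap t).1.
(* [H] is a measurable bound of the constraint sum: each step length is
   replaced by [b t s / T]. *)
pose b t s := w * D1 + D2 * (m%:R * Y t s).
pose H s := Y T.+1 s + D2 * (w ^- 2 * \sum_(1 <= t < T.+1) b t s).
have b_ge0 t s : 0 <= b t s.
  by rewrite addr_ge0 ?mulr_ge0 ?lyapunov_ge0 ?ler0n// ltW.
have sum_b_ge0 s : 0 <= \sum_(1 <= t < T.+1) b t s by exact: sumr_ge0.
have H_ge0 s : 0 <= H s.
  by rewrite addr_ge0 ?lyapunov_ge0// !mulr_ge0 ?invr_ge0 ?sqr_ge0// ltW.
have sumQ_le t s : (1 <= t)%N -> \sum_j Q t s 0 j <= m%:R * Y t s.
  move=> t1; rewrite mulr_natl -[X in _ *+ X](card_ord m) -sumr_const.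
  by apply: ler_sum => j _; have /andP[] := QY t j s t1.
have gH s : \sum_(1 <= t < T.+1) g k (x t s) (omega t s) <= H s.
  have := constraint_sum_le (fun t' j y _ X0y =>
    gradg_bound basic j (omega t' s) X0y) (run s) T k.
  move=> /le_trans; apply; rewrite /H lerD//.
    by have /andP[] := QY T.+1 k s isT.
  rewrite ler_wpM2l ?(ltW hD2)// mulr_sumr.
  rewrite big_seq_cond [leRHS]big_seq_cond; apply: ler_sum => t.
  rewrite andbT mem_index_iota => /andP[t1 _].
  rewrite mulrC ler_pdivlMr ?exprn_gt0// mulrC -w2.
  have := step_length (ltW w0) (fun t' y t1 X0y => gradf_bound basic s t1 X0y)
    (fun t' j y _ X0y => gradg_bound basic j (omega t' s) X0y) (run s) t1.
  move=> /le_trans; apply; rewrite /b lerD2l ler_wpM2l ?(ltW hD2)//.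
  exact: sumQ_le.
have i1 a : P.-integrable setT (EFin \o (fun=> a)).
  exact: finite_measure_integrable_cst.
have iZ a (h : S -> R) : P.-integrable setT (EFin \o h) ->
    P.-integrable setT (EFin \o (fun s => a * h s)).
  exact: (@integrableZl _ _ _ P _ measurableT a).
pose b' t := b t.+1.
have ib t : P.-integrable setT (EFin \o b' t).
  exact: (integrableD measurableT (i1 (w * D1)) (iZ D2 _ (iZ m%:R _ (iY t)))).
have sum_b s : \sum_(1 <= t < T.+1) b t s = \sum_(0 <= t < T) b' t s.
  by rewrite big_add1.
have isb : P.-integrable setT (EFin \o (fun s => \sum_(0 <= t < T) b' t s)).
  exact: integrable_Rsum.
have HE : H = fun s => Y T.+1 s + D2 * (w ^- 2 * \sum_(0 <= t < T) b' t s).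
  by apply/funext => s; rewrite /H sum_b.
have iH : P.-integrable setT (EFin \o H).
  rewrite HE.
  exact: (integrableD measurableT (iY T) (iZ D2 _ (iZ (w ^- 2) _ isb))).
have EH : \int[P]_s H s <= (C1 + D2 * (D1 + D2 * (m%:R * C1))) * w.
  rewrite HE RintegralD//; last exact/iZ/iZ.
  rewrite [leRHS]mulrDl lerD// RintegralZl//; last exact/iZ.
  rewrite RintegralZl// Rintegral_sum// -mulrA ler_wpM2l ?(ltW hD2)//.
  rewrite mulrC ler_pdivrMr ?exprn_gt0// -w2 mulrC.
  rewrite [leRHS]mulr_natl -[X in _ *+ X]subn0 -sumr_const_nat.
  apply: ler_sum => t _.
  rewrite RintegralD//; last exact/iZ/iZ.
  rewrite mulrDl lerD//.
    by rewrite Rintegral_probability_cst mulrC.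
  rewrite RintegralZl//; last exact/iZ.
  by rewrite RintegralZl// -mulrA ler_wpM2l ?(ltW hD2)// -mulrA ler_wpM2l.
rewrite unlock; apply: (@le_trans _ _ (\int[P]_s (H s)%:E)%E).
  by apply: le_integral_of_ge0_bound => s; rewrite lee_fin.
rewrite -(fineK (integrable_fin_num measurableT iH)) lee_fin.
exact: EH.
Qed.
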